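(* Let $V,T$ be finite-dimensional complex vector spaces and let $M_{a,b}=M_{a,b}(t)\in\mathrm{End}(V)$, $a,b\ge0$, be a family of endomorphisms depending on $t\in T$ (power series, or a formal germ at $0\in T$). Let $\mu:\mathcal V_+\to\mathcal V_-$ be the associated ($t$-dependent) linear map, $$\mu\Bigl(\sum_{i\ge0}q_iz^i\Bigr)=\sum_{a\ge0}(-z)^{-a-1}\Bigl(\sum_{i\ge0}M_{a,i}q_i\Bigr),$$ and let $\varphi=\pi\circ z^{-1}\circ j:\mathcal V_+\to\mathcal V_-$. The following two characterizations of $\mu$ are equivalent: (a) the matrices $M_{a,b}$ satisfy the master equations $dM_{a+1,b}=M_{a,0}\,dM_{0,b}$, $dM_{a,b+1}=dM_{a,0}\,M_{0,b}$, $M_{a+1,b}+M_{a,b+1}=M_{a,0}M_{0,b}$ for all $a,b\ge0$ (with $d=d_t$); (b) the image of $\varphi$ is isomorphic to $V$, and the differential $d_t\mu:\mathcal V_+\otimes T\to\mathcal V_-$ factorizes through the map $\varphi\otimes\mathrm{id}$.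
   Context: $\mathcal V=V\otimes\mathbb C[[z^{-1},z]$ is the space of $V$-valued Laurent series $\dots+q_1^*(-z)^{-2}+q_0^*(-z)^{-1}+q_0+q_1z+q_2z^2+\dots$ with $q_i,q_i^*\in V$ and $q_i=0$ for $i$ large enough (infinitely many negative powers of $z$ allowed, finitely many positive ones). $\mathcal V_+=V\otimes\mathbb C[z]$ and $\mathcal V_-=V\otimes z^{-1}\mathbb C[[z^{-1}]]$, so $\mathcal V=\mathcal V_+\oplus\mathcal V_-$. $\mathcal V_\mu=\{f+\mu(f):f\in\mathcal V_+\}\subset\mathcal V$ is the graph of $\mu$, a subspace transversal to $\mathcal V_-$; $j:\mathcal V_+\to\mathcal V_\mu$, $j(f)=f+\mu(f)$, is the natural identification; $\pi:\mathcal V\to\mathcal V_-$ is the projection to $\mathcal V_-$ along $\mathcal V_\mu$; $z^{-1}$ is the operator of multiplication by $z^{-1}$. All the maps $\mu,j,\pi,\varphi$ depend on $t$; one works in (a formal germ at $0$ of) the trivial bundle $\mathcal V\times T\to T$, and $\varphi\otimes\mathrm{id}:\mathcal V_+\otimes T\to\mathcal V_-\otimes T$. *)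

(* Defs.v *)
From HB Require Import structures.
From mathcomp Require Import all_boot all_order all_algebra.
From mathcomp Require Import mpoly complex.
From mathcomp Require Import boolp classical_sets functions fsbigop reals.

Set Implicit Arguments.
Unset Strict Implicit.
Unset Printing Implicit Defensive.

Import Order.TTheory GRing.Theory Num.Theory.
Local Open Scope ring_scope.

(* [fps T A] is A[[t_1, ..., t_m]], where m = dim T and t_1, ..., t_m are the
   linear coordinates on T dual to [vbasis {:T}]: formal germs at 0 in T of
   A-valued functions.  The value at a multi-index is the coefficient of the
   corresponding monomial. *)
Definition fps (F : fieldType) (T : vectType F) (A : Type) :=
  'X_{1..\dim {:T}} -> A.

HB.instance Definition _ (F : fieldType) (T : vectType F) (A : zmodType) :=
  GRing.Zmodule.copy (fps T A) ('X_{1..\dim {:T}} -> A).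

Section Convolution.
Context {F : fieldType} {T : vectType F}.
Local Notation n := (\dim {:T}).
Implicit Types alpha : 'X_{1..n}.

(* The product of power series induced by a biadditive pairing [op] of their
   coefficients. *)
Definition conv (A B C : zmodType) (op : A -> B -> C)
    (f : fps T A) (g : fps T B) : fps T C :=
  fun alpha => \sum_(b : 'X_{1..n < (mdeg alpha).+1}
                      | (bmnm b <= alpha)%MM)
                 op (f b) (g (alpha - b)%MM).

Definition biadditive (A B C : zmodType) (op : A -> B -> C) :=
  (forall b, {morph op^~ b : x y / x + y}) /\
  (forall a, {morph op a : x y / x + y}).

Lemma morphD0 (A C : zmodType) (h : A -> C) :
  {morph h : x y / x + y} -> h 0 = 0.
Proof. by move=> hD; apply: (addrI (h 0)); rewrite -hD !addr0. Qed.

Lemma conv_pairE (A B C : zmodType) (op : A -> B -> C) f g alpha d :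
  (mdeg alpha < d)%N ->
  conv op f g alpha = \sum_(x : 'X_{1..n < d})
     \sum_(y : 'X_{1..n < d} | alpha == (bmnm x + bmnm y)%MM)
        op (f x) (g y).
Proof.
move=> ltd; rewrite /conv.
have E : forall (x : 'X_{1..n < d}),
  \sum_(y : 'X_{1..n < d} | alpha == (bmnm x + bmnm y)%MM)
        op (f x) (g y)
  = if (bmnm x <= alpha)%MM then op (f x) (g (alpha - x)%MM) else 0.
  move=> x; case: ifPn => [le|nle]; last first.
    rewrite big1 // => y /eqP E; case/negP: nle; rewrite E.
    exact: lem_addr.
  have lt' : (mdeg (alpha - bmnm x)%MM < d)%N.
    exact: leq_ltn_trans (mdegB _ _) ltd.
  rewrite (big_pred1 (BMultinom lt')) // => y; rewrite /pred1 /= [RHS]bmeqP /=.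
  apply/eqP/eqP => [->|->]; last by rewrite [RHS]addmC submK.
  by rewrite [X in (X - _)%MM]addmC addmK.
under [RHS]eq_bigr do rewrite E.
rewrite -big_mkcond.
have wd : forall b : 'X_{1..n < (mdeg alpha).+1},
   (mdeg (bmnm b) < d)%N.
  by move=> [b /= lb]; apply: leq_trans lb ltd.
pose h b : 'X_{1..n < d} := BMultinom (wd b).
have lt0 : (mdeg (0%MM : 'X_{1..\dim {:T}}) < (mdeg alpha).+1)%N by rewrite mdeg0.
pose h' (b : 'X_{1..n < d}) : 'X_{1..n < (mdeg alpha).+1} :=
  insubd (BMultinom lt0) (bmnm b).
rewrite [RHS](reindex_onto h h') /=; last first.
  move=> b le; apply: val_inj; rewrite /= /h' val_insubd.
  have -> // : (mdeg (bmnm b) < (mdeg alpha).+1)%N.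
  by rewrite ltnS -(submK le) mdegD leq_addl.
apply: eq_bigl => b /=; case: (_ <= _)%MM => //=.
apply/esym/eqP/val_inj; rewrite /h' val_insubd /=.
by case: b => /= b ->.
Qed.

Lemma fpsDE (A : zmodType) (f g : fps T A) alpha :
  (f + g) alpha = f alpha + g alpha.
Proof. by []. Qed.

Lemma convC (A C : zmodType) (op : A -> A -> C) f g :
  (forall x y, op x y = op y x) -> conv op f g = conv op g f.
Proof.
move=> opC; apply/funext => alpha.
rewrite !(conv_pairE _ _ _ (ltnSn _)).
under eq_bigr do rewrite big_mkcond.
rewrite exchange_big /=; apply: eq_bigr => x _.
rewrite [RHS]big_mkcond; apply: eq_bigr => y _.
by rewrite addmC opC.
Qed.

Lemma convDl (A B C : zmodType) (op : A -> B -> C) f1 f2 g :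
  biadditive op -> conv op (f1 + f2) g = conv op f1 g + conv op f2 g.
Proof.
move=> [opl _]; apply/funext => alpha; rewrite fpsDE /conv -big_split /=.
by apply: eq_bigr => b _; rewrite -opl.
Qed.

Lemma convDr (A B C : zmodType) (op : A -> B -> C) f g1 g2 :
  biadditive op -> conv op f (g1 + g2) = conv op f g1 + conv op f g2.
Proof.
move=> [_ opr]; apply/funext => alpha; rewrite fpsDE /conv -big_split /=.
by apply: eq_bigr => b _; rewrite -opr.
Qed.

Lemma convA (A B C AB BC D : zmodType) (op1 : A -> B -> AB) (op2 : AB -> C -> D)
    (op3 : B -> C -> BC) (op4 : A -> BC -> D) f g h :
  biadditive op2 -> biadditive op4 ->
  (forall x y z, op2 (op1 x y) z = op4 x (op3 y z)) ->
  conv op2 (conv op1 f g) h = conv op4 f (conv op3 g h).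
Proof.
move=> [op2D _] [_ op4D] opA; apply/funext => alpha.
have [d dP] : exists d, (mdeg alpha < d)%N by exists (mdeg alpha).+1.
rewrite !(conv_pairE _ _ _ dP).
pose G (x y z : 'X_{1..n < d}) :=
  if alpha == (bmnm x + bmnm y + bmnm z)%MM
  then op4 (f x) (op3 (g y) (h z)) else 0.
transitivity (\sum_z \sum_x \sum_y G x y z).
  rewrite (exchange_big_dep xpredT) //=; apply: eq_bigr => z _.
  transitivity (\sum_(b : 'X_{1..n < d} | alpha == (bmnm b + bmnm z)%MM)
     \sum_(x : 'X_{1..n < d}) \sum_(y : 'X_{1..n < d})
       if bmnm b == (bmnm x + bmnm y)%MM
       then op4 (f x) (op3 (g y) (h z)) else 0).
    apply: eq_bigr => b _; rewrite (conv_pairE _ _ _ (bmdeg b)).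
    rewrite (big_morph (op2^~ _) (op2D _) (morphD0 (op2D _))).
    apply: eq_bigr => x _.
    rewrite (big_morph (op2^~ _) (op2D _) (morphD0 (op2D _))).
    by rewrite [LHS]big_mkcond /=; apply: eq_bigr => y _; rewrite opA.
  rewrite exchange_big /=; apply: eq_bigr => x _.
  rewrite exchange_big /=; apply: eq_bigr => y _.
  rewrite /G; case: ifPn => [/eqP E|ne].
    have lt' : (mdeg (bmnm x + bmnm y)%MM < d)%N.
      by apply: leq_ltn_trans dP; rewrite E !mdegD leq_addr.
    rewrite -big_mkcondr (big_pred1 (BMultinom lt')) // => b.
    rewrite /pred1 /= [RHS]bmeqP /=; apply/andP/eqP => [[_ /eqP->]//|->].
    by rewrite -E.
  rewrite big1 // => b /eqP Eb; case: ifPn => // /eqP Eb'.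
  by rewrite Eb Eb' eqxx in ne.
rewrite exchange_big; apply: eq_bigr => x _ /=.
transitivity (\sum_(b : 'X_{1..n < d} | alpha == (bmnm x + bmnm b)%MM)
     \sum_(y : 'X_{1..n < d}) \sum_(z : 'X_{1..n < d})
       if bmnm b == (bmnm y + bmnm z)%MM
       then op4 (f x) (op3 (g y) (h z)) else 0); last first.
  apply: eq_bigr => b _; rewrite (conv_pairE _ _ _ (bmdeg b)).
  rewrite (big_morph (op4 _) (op4D _) (morphD0 (op4D _))).
  apply: eq_bigr => y _.
  rewrite (big_morph (op4 _) (op4D _) (morphD0 (op4D _))).
  by rewrite [RHS]big_mkcond.
rewrite exchange_big [RHS]exchange_big; apply: eq_bigr => y _ /=.
rewrite exchange_big /=; apply: eq_bigr => z _.
rewrite /G; case: ifPn => [/eqP E|ne].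
  have lt' : (mdeg (bmnm y + bmnm z)%MM < d)%N.
    by apply: leq_ltn_trans dP; rewrite E !mdegD -addnA leq_addl.
  rewrite -big_mkcondr (big_pred1 (BMultinom lt')) // => b.
  rewrite /pred1 /= [RHS]bmeqP /=; apply/andP/eqP => [[_ /eqP->]//|->].
  by rewrite E addmA.
rewrite big1 // => b /eqP Eb; case: ifPn => // /eqP Eb'.
by rewrite Eb Eb' addmA eqxx in ne.
Qed.
End Convolution.

Section ScalarRing.
Context {F : fieldType} {T : vectType F}.

Definition fps_one : fps T F := fun alpha => (alpha == 0%MM)%:R.
Definition fps_mul : fps T F -> fps T F -> fps T F := conv *%R.

Lemma conv1 (A : zmodType) (op : F -> A -> A) (f : fps T A) :
  biadditive op -> (forall a, op 1 a = a) -> conv op fps_one f = f.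
Proof.
move=> [opD _] op1; apply/funext => alpha; rewrite /conv.
have lt0 : (mdeg (0%MM : 'X_{1..\dim {:T}}) < (mdeg alpha).+1)%N.
  by rewrite mdeg0.
rewrite (bigD1 (BMultinom lt0)) /=; last first.
  by apply/mnm_lepP => i; rewrite mnm0E.
rewrite big1 => [|b /andP[_ nb]]; first by rewrite /fps_one eqxx op1 subm0 addr0.
have -> : fps_one b = 0.
  by move: nb; rewrite bmeqP /= /fps_one => /negbTE ->.
exact: morphD0 (opD _).
Qed.

Lemma biadd_mul : biadditive (@GRing.mul F).
Proof. by split=> a x y; rewrite (mulrDl, mulrDr). Qed.

Lemma fps_mulA : associative fps_mul.
Proof.
move=> f g h; apply/esym/convA; [exact: biadd_mul|exact: biadd_mul|].
by move=> x y z; rewrite mulrA.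
Qed.

Lemma fps_mulC : commutative fps_mul.
Proof. by move=> f g; apply/convC/mulrC. Qed.

Lemma fps_mul1 : left_id fps_one fps_mul.
Proof. by move=> f; apply: conv1 biadd_mul (@mul1r _). Qed.

Lemma fps_mulDl : left_distributive fps_mul +%R.
Proof. by move=> f g h; apply/convDl/biadd_mul. Qed.

Lemma fps_one_neq0 : fps_one != 0.
Proof.
apply/eqP => /(congr1 (fun f => f 0%MM)); rewrite /fps_one eqxx.
exact/eqP/oner_neq0.
Qed.

End ScalarRing.

HB.instance Definition _ (F : fieldType) (T : vectType F) :=
  GRing.Zmodule_isComNzRing.Build (fps T F)
    fps_mulA fps_mulC fps_mul1 fps_mulDl fps_one_neq0.

Section FpsModule.
Context {F : fieldType} {T : vectType F} {W : lmodType F}.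

Definition fps_scale : fps T F -> fps T W -> fps T W := conv *:%R.

Lemma biadd_scale : biadditive (@GRing.scale F W).
Proof. by split=> a x y; rewrite (scalerDl, scalerDr). Qed.

Lemma fps_scaleA a b v :
  fps_scale a (fps_scale b v) = fps_scale (a * b) v.
Proof.
apply/esym/convA; [exact: biadd_scale|exact: biadd_scale|].
by move=> x y z; rewrite scalerA.
Qed.

Lemma fps_scale1 : left_id 1 fps_scale.
Proof. by move=> f; apply: conv1 biadd_scale (@scale1r _ _). Qed.

Lemma fps_scaleDr : right_distributive fps_scale +%R.
Proof. by move=> f g h; apply/convDr/biadd_scale. Qed.

Lemma fps_scaleDl v : {morph fps_scale^~ v : a b / a + b}.
Proof. by move=> f g; apply/convDl/biadd_scale. Qed.

End FpsModule.

HB.instance Definition _ (F : fieldType) (T : vectType F) (W : lmodType F) :=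
  GRing.Zmodule_isLmodule.Build (fps T F) (fps T W)
    fps_scaleA fps_scale1 fps_scaleDr fps_scaleDl.

Section Differential.
Context {F : fieldType} {T : vectType F} {W : lmodType F}.

Definition fps_partial (i : 'I_(\dim {:T})) (f : fps T W) : fps T W :=
  fun alpha => f (alpha + U_(i))%MM *+ (alpha i).+1.

(* The differential [df] of a W-valued series, evaluated on a tangent vector. *)
Definition fps_d (f : fps T W) (tau : T) : fps T W :=
  fun alpha => \sum_i coord (vbasis {:T}) i tau *: fps_partial i f alpha.

End Differential.

Section Loop.
Context {F : fieldType} (V T : vectType F).

Local Notation K := (fps T F).
Local Notation VK := (fps T V).
Local Notation EndVK := (fps T 'End(V)).

Definition endo_mul (A B : EndVK) : EndVK := conv (@comp_lfun F V V V) A B.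
Definition endo_app (A : EndVK) (v : VK) : VK :=
  conv (fun (a : 'End(V)) x => a x) A v.

Lemma biadd_app : biadditive (fun (a : 'End(V)) x => a x).
Proof. by split=> a x y; rewrite (add_lfunE, linearD). Qed.

Lemma endo_app_is_linear A : linear (endo_app A).
Proof.
move=> c u v; rewrite /endo_app convDr; last exact: biadd_app.
congr (_ + _); rewrite /GRing.scale /= /fps_scale.
have e : conv (fun (x : V) (a : F) => a *: x) = fun u c => conv *:%R c u :> fps T V.
  apply/funext => {}u; apply/funext => {}c; apply/funext => alpha.
  rewrite !(conv_pairE _ _ _ (ltnSn _)).
  under eq_bigr do rewrite big_mkcond.
  rewrite exchange_big /=; apply: eq_bigr => x _.
  by rewrite [RHS]big_mkcond; apply: eq_bigr => y _; rewrite addmC.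
have bs : biadditive (fun (x : V) (a : F) => a *: x).
  by split=> a x y; rewrite (scalerDl, scalerDr).
rewrite -(congr1 (fun h => h u c) e) -[RHS](congr1 (fun h => h _ c) e).
apply/esym/convA => //; first exact: biadd_app.
by move=> x y z; rewrite linearZ.
Qed.

HB.instance Definition _ A :=
  GRing.isLinear.Build K VK VK _ (endo_app A) (endo_app_is_linear A).

(* V-valued Laurent series in z^-1 with coefficients in K = F[[t]]: the value
   at k is the coefficient of z^k. *)
Definition laurent_pred : {pred int -> VK} :=
  [pred g : int -> VK | `[< exists N : int, forall k, N < k -> g k = 0 >]].

Lemma laurent_submod : submod_closed laurent_pred.
Proof.
split=> [|a g h]; first by apply/asboolP; exists 0.
move=> /asboolP[N gN] /asboolP[N' hN]; apply/asboolP.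
exists (Num.max N N'); move=> k; rewrite gt_max => /andP[lt lt'].
by rewrite /= (_ : (_ + _) k = a *: g k + h k) // gN ?hN // scaler0 addr0.
Qed.
HB.instance Definition _ :=
  GRing.isSubmodClosed.Build K (int -> VK) laurent_pred laurent_submod.

Record laurent := Laurent {
  lcoef :> int -> VK;
  lcoefP : lcoef \in laurent_pred }.
HB.instance Definition _ := [isSub for lcoef].
HB.instance Definition _ := [Choice of laurent by <:].
HB.instance Definition _ := [SubChoice_isSubLmodule of laurent by <:].

Definition plus_pred : {pred laurent} :=
  [pred g : laurent | `[< forall k : int, k < 0 -> g k = 0 >]].
Definition minus_pred : {pred laurent} :=
  [pred g : laurent | `[< forall k : int, 0 <= k -> g k = 0 >]].

Lemma laurentDE (c : K) (g h : laurent) k : (c *: g + h) k = c *: g k + h k.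
Proof. by []. Qed.

Lemma laurent_addE (g h : laurent) k : (g + h) k = g k + h k.
Proof. by []. Qed.

Lemma plus_submod : submod_closed plus_pred.
Proof.
split=> [|a g h]; first by apply/asboolP.
move=> /asboolP gN /asboolP hN; apply/asboolP => k lt.
by rewrite laurentDE gN // hN // scaler0 addr0.
Qed.
HB.instance Definition _ :=
  GRing.isSubmodClosed.Build K laurent plus_pred plus_submod.

Lemma minus_submod : submod_closed minus_pred.
Proof.
split=> [|a g h]; first by apply/asboolP.
move=> /asboolP gN /asboolP hN; apply/asboolP => k le.
by rewrite laurentDE gN // hN // scaler0 addr0.
Qed.
HB.instance Definition _ :=
  GRing.isSubmodClosed.Build K laurent minus_pred minus_submod.

Record Vplus := VPlus { plus_val :> laurent; plus_valP : plus_val \in plus_pred }.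
HB.instance Definition _ := [isSub for plus_val].
HB.instance Definition _ := [Choice of Vplus by <:].
HB.instance Definition _ := [SubChoice_isSubLmodule of Vplus by <:].

Record Vminus :=
  VMinus { minus_val :> laurent; minus_valP : minus_val \in minus_pred }.
HB.instance Definition _ := [isSub for minus_val].
HB.instance Definition _ := [Choice of Vminus by <:].
HB.instance Definition _ := [SubChoice_isSubLmodule of Vminus by <:].

Fact plus_part_laurent (g : laurent) :
  (fun k : int => if 0 <= k then g k else 0) \in laurent_pred.
Proof.
have /asboolP[N gN] := lcoefP g; apply/asboolP; exists N => k /gN ->.
by case: ifP.
Qed.
Fact plus_part_plus (g : laurent) :
  Laurent (plus_part_laurent g) \in plus_pred.
Proof. by apply/asboolP => k; rewrite ltNge /= => /negbTE ->. Qed.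
Definition plus_part (g : laurent) : Vplus := VPlus (plus_part_plus g).

Fact minus_part_laurent (g : laurent) :
  (fun k : int => if k < 0 then g k else 0) \in laurent_pred.
Proof.
have /asboolP[N gN] := lcoefP g; apply/asboolP; exists N => k /gN ->.
by case: ifP.
Qed.
Fact minus_part_minus (g : laurent) :
  Laurent (minus_part_laurent g) \in minus_pred.
Proof. by apply/asboolP => k; rewrite leNgt /= => /negbTE ->. Qed.
Definition minus_part (g : laurent) : Vminus := VMinus (minus_part_minus g).

Lemma plus_minus_part g :
  (plus_part g : laurent) + (minus_part g : laurent) = g.
Proof.
apply/val_inj/funext => k.
rewrite [LHS]laurent_addE /=.
by rewrite ltNge; case: (0 <= k); rewrite ?addr0 ?add0r.
Qed.

Lemma plus_partD (f : Vplus) (h : Vminus) :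
  plus_part ((f : laurent) + (h : laurent)) = f.
Proof.
apply/val_inj/val_inj/funext => k.
rewrite [LHS](_ : _ = if 0 <= k then f k + h k else 0) //.
have /asboolP f0 := plus_valP f; have /asboolP h0 := minus_valP h.
by case: leP => k0; [rewrite h0 // addr0 | apply/esym/f0].
Qed.

Lemma minus_partD (f : Vplus) (h : Vminus) :
  minus_part ((f : laurent) + (h : laurent)) = h.
Proof.
apply/val_inj/val_inj/funext => k.
rewrite [LHS](_ : _ = if k < 0 then f k + h k else 0) //.
have /asboolP f0 := plus_valP f; have /asboolP h0 := minus_valP h.
by case: ltP => k0; [rewrite f0 // add0r | apply/esym/h0].
Qed.

(* The element of V_- given by the sum of the (-z)^(-a-1) h_a over a >= 0;
   [Negz a] is the integer -a-1. *)
Definition minus_fun (h : nat -> VK) : int -> VK :=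
  fun k => match k with Posz _ => 0 | Negz a => (-1) ^+ a.+1 *: h a end.
Fact minus_fun_laurent h : minus_fun h \in laurent_pred.
Proof. by apply/asboolP; exists 0; case. Qed.
Fact minus_fun_minus h : Laurent (minus_fun_laurent h) \in minus_pred.
Proof. by apply/asboolP; case. Qed.
Definition minus_series (h : nat -> VK) : Vminus := VMinus (minus_fun_minus h).

Fact zinv_laurent (g : laurent) : (fun k : int => g (k + 1)) \in laurent_pred.
Proof.
have /asboolP[N gN] := lcoefP g; apply/asboolP; exists N => k lt.
by apply: gN; rewrite (lt_trans lt) // ltrDl.
Qed.
Definition zinv (g : laurent) : laurent := Laurent (zinv_laurent g).

Section Mu.
Variable M : nat -> nat -> EndVK.

(* The sum over i has finite support. *)
Definition mu (f : Vplus) : Vminus :=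
  minus_series (fun a => \sum_(i \in [set: nat]) endo_app (M a i) (f (Posz i))).

Lemma laurent_bound (g : laurent) :
  exists n, forall i, (n <= i)%N -> g (Posz i) = 0.
Proof.
have /asboolP[N gN] := lcoefP g; exists `|N|.+1%N => i lt; apply: gN.
by rewrite (le_lt_trans (ler_norm N)) // -abszE ltz_nat.
Qed.

Lemma mu_sumE (f : Vplus) n a : (forall i, (n <= i)%N -> f (Posz i) = 0) ->
  \sum_(i \in [set: nat]) endo_app (M a i) (f (Posz i)) =
  \sum_(0 <= i < n) endo_app (M a i) (f (Posz i)).
Proof.
move=> fn; rewrite (fsbigE (index_iota 0 n)) ?iota_uniq //.
  by apply: eq_bigl => i; rewrite in_setT.
move=> i _; rewrite mem_index_iota /= -leqNgt => /fn ->.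
exact: linear0.
Qed.

Lemma mu_is_linear : linear mu.
Proof.
move=> c f g; apply/val_inj/val_inj/funext; case=> [k|a].
  by rewrite [RHS](_ : _ = c *: 0 + 0) // scaler0 addr0.
have [n1 f0] := laurent_bound f; have [n2 g0] := laurent_bound g.
rewrite [LHS](_ : _ = (-1) ^+ a.+1 *: \sum_(i \in [set: nat])
   endo_app (M a i) ((c *: f + g) (Posz i))) //.
rewrite [RHS](_ : _ = c *: ((-1) ^+ a.+1 *: \sum_(i \in [set: nat])
   endo_app (M a i) (f (Posz i))) + (-1) ^+ a.+1 *: \sum_(i \in [set: nat])
   endo_app (M a i) (g (Posz i))) //.
have fgE i : (c *: f + g) (Posz i) = c *: f (Posz i) + g (Posz i) by [].
rewrite !(@mu_sumE _ (maxn n1 n2)).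
- rewrite scalerA mulrC -scalerA -scalerDr; congr (_ *: _).
  rewrite scaler_sumr -big_split; apply: eq_bigr => i _.
  by rewrite fgE linearP.
- by move=> i; rewrite geq_max => /andP[_ /g0].
- by move=> i; rewrite geq_max => /andP[/f0].
by move=> i; rewrite geq_max fgE => /andP[/f0 -> /g0 ->]; rewrite scaler0 addr0.
Qed.
HB.instance Definition _ :=
  GRing.isLinear.Build K Vplus Vminus _ mu mu_is_linear.

Definition jmu (f : Vplus) : laurent := (f : laurent) + (mu f : laurent).

Definition Vmu : set laurent := range jmu.

(* The projection to V_- along V_mu, see [proj_along] and [proj_unique]. *)
Definition proj (g : laurent) : Vminus := minus_part g - mu (plus_part g).

Lemma proj_along g : Vmu (g - (proj g : laurent)).
Proof.
have e : (plus_part g : laurent) = g - (minus_part g : laurent).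
  by apply/eqP; rewrite eq_sym subr_eq plus_minus_part.
exists (plus_part g) => //; rewrite /jmu {1}e.
by rewrite (_ : minus_val (proj g) = (minus_part g : laurent)
  - (mu (plus_part g) : laurent)) // opprB addrA addrAC.
Qed.

Lemma proj_unique g (h : Vminus) : Vmu (g - (h : laurent)) -> h = proj g.
Proof.
move=> [f _ E].
have {E}-> : g = (f : laurent) + ((h + mu f : Vminus) : laurent).
  by rewrite -[g](subrK (h : laurent)) -E /jmu -addrA [X in _ + X]addrC.
by rewrite /proj plus_partD minus_partD addrK.
Qed.

Definition phi (f : Vplus) : Vminus := proj (zinv (jmu f)).

Lemma phi_is_linear : linear phi.
Proof.
move=> c f g; apply/esym/proj_unique.
have /(_ f)[f' _ Ef] := fun f => proj_along (zinv (jmu f)).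
have /(_ g)[g' _ Eg] := fun f => proj_along (zinv (jmu f)).
exists (c *: f' + g') => //.
have jP u v : jmu (c *: u + v) = c *: jmu u + jmu v.
  rewrite /jmu linearP (_ : minus_val _ = c *: (mu u : laurent) + mu v) //.
  by rewrite (_ : plus_val _ = c *: (u : laurent) + v) // scalerDr addrACA.
rewrite !jP Ef Eg.
have -> : minus_val (c *: phi f + phi g) =
  c *: (phi f : laurent) + (phi g : laurent) by [].
have -> : zinv (c *: jmu f + jmu g) = c *: zinv (jmu f) + zinv (jmu g).
  exact/val_inj/funext.
by rewrite scalerBr [in RHS]opprD addrACA.
Qed.
HB.instance Definition _ :=
  GRing.isLinear.Build K Vplus Vminus _ phi phi_is_linear.

End Mu.

(* [tensT W] is the tensor product of W and T over F: the family w stands for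
   the sum of the w_i (x) e_i, where e is the basis [vbasis {:T}] of T. *)
Definition tensT (W : lmodType K) := {ffun 'I_(\dim {:T}) -> W}.
HB.instance Definition _ W := GRing.Lmodule.on (tensT W).

Definition tensT_map (W W' : lmodType K) (g : W -> W') (w : tensT W) : tensT W' :=
  [ffun i => g (w i)].

(* The differential of mu, seen as an operator-valued function of t: it sends f (x) tau to
   the value at f of the derivative of mu along tau. *)
Definition d_mu (M : nat -> nat -> EndVK) (w : tensT Vplus) : Vminus :=
  \sum_(i < \dim {:T}) mu (fun a b => fps_d (M a b) (vbasis {:T})`_i) (w i).

Definition master_equations (M : nat -> nat -> EndVK) :=
  forall a b : nat,
    [/\ forall tau, fps_d (M a.+1 b) tau = endo_mul (M a 0%N) (fps_d (M 0%N b) tau),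
        forall tau, fps_d (M a b.+1) tau = endo_mul (fps_d (M a 0%N) tau) (M 0%N b)
      & M a.+1 b + M a b.+1 = endo_mul (M a 0%N) (M 0%N b)].

(* Over the formal germ, V is the trivial bundle with fibre V, that is the
   K-module V[[t]]. *)
Definition image_iso_V (M : nat -> nat -> EndVK) :=
  exists g : {linear VK -> Vminus}, injective g /\ range g = range (phi M).

Definition d_mu_factors (M : nat -> nat -> EndVK) :=
  exists psi : {linear tensT Vminus -> Vminus},
    forall w, d_mu M w = psi (tensT_map (phi M) w).

End Loop.

(* Main.v *)
Require Import Defs.
From HB Require Import structures.
From mathcomp Require Import all_boot all_order all_algebra.
From mathcomp Require Import mpoly complex.
From mathcomp Require Import boolp classical_sets reals.

Set Implicit Arguments.
Unset Strict Implicit.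
Unset Printing Implicit Defensive.

Import Order.TTheory GRing.Theory Num.Theory.
Local Open Scope ring_scope.

(** Write [K] for the ring of formal germs F[[t]], and
    [phi f = sum_a (-z)^(-a-1) phi_a f].  For [f = sum_i q_i z^i],
      [phi_0 f = - (q_0 + sum_i M_{0,i} q_{i+1})],
      [phi_{a+1} f = - (M_{a,0} q_0 + sum_i (M_{a+1,i} + M_{a,i+1}) q_{i+1})].
    Since [phi_0] is minus the identity on constants, the map
    [retract M : f |-> - phi_0 f] is a projection of [V_+] onto the constants
    [V[[t]]], with the same kernel as [phi_0].  The proof compares everything
    with this projection.

    - [phi] factors through [retract M], i.e. [phi f = phi (retract M f)], if
      and only if [M_{a+1,b} + M_{a,b+1} = M_{a,0} M_{0,b}]: both sides are
      linear in [f], so it suffices to read off the coefficients on the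
      monomials [v z^i] ([phi_retractP]).
    - In the same way, the derivative of [mu] along a vector factors through
      [retract M] if and only if [d M_{a,b+1} = d M_{a,0} M_{0,b}]
      ([mu_retractP]).
    - If [phi] factors through [retract M], its image is [phi] of the constants,
      where [phi_0] is minus the identity, so the image is isomorphic to
      [V[[t]]].  Conversely, an isomorphism from [V[[t]]] onto the image,
      followed by [phi_0], is a surjective endomorphism of the free [K]-module
      [V[[t]]] of finite rank, hence injective; so an element of the image of
      [phi] is determined by its leading coefficient, which is the same for
      [phi f] and [phi (retract M f)] ([image_iso_VP]).
    - Once [phi] factors through [retract M], the maps [phi] and [retract M]
      determine each other, so that factoring through [phi] and factoring
      through [retract M] mean the same for [d mu] ([d_mu_factorsP]).

    This identifies (b) with the last two master equations, and the first one,
    [d M_{a+1,b} = M_{a,0} d M_{0,b}], is obtained by differentiating the third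
    with the Leibniz rule ([fps_partial_conv]) and subtracting the second. *)

(** * Products and partial derivatives of power series *)

Section Convolution.
Context {F : fieldType} {T : vectType F}.
Local Notation n := (\dim {:T}).

Lemma conv_flip (A B C : zmodType) (op : A -> B -> C)
    (f : fps T A) (g : fps T B) :
  conv op f g = conv (fun y x => op x y) g f.
Proof.
apply/funext => alpha; rewrite !(conv_pairE _ _ _ (ltnSn _)).
under eq_bigr do rewrite big_mkcond.
rewrite exchange_big; apply: eq_bigr => x _.
by rewrite [RHS]big_mkcond; apply: eq_bigr => y _; rewrite addmC.
Qed.

Lemma biadditive_flip (A B C : zmodType) (op : A -> B -> C) :
  biadditive op -> biadditive (fun y x => op x y).
Proof. by case. Qed.

Lemma biadditive_mulrnl (A B C : zmodType) (op : A -> B -> C) x y k :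
  biadditive op -> op (x *+ k) y = op x y *+ k.
Proof.
move=> [opD _]; elim: k => [|k IH]; first by rewrite !mulr0n (morphD0 (opD y)).
by rewrite !mulrS opD IH.
Qed.

(** The Euler operator [t_i d/dt_i].  Unlike [d/dt_i] it does not shift
    multi-indices, which makes its Leibniz rule a termwise identity. *)
Definition fps_euler (A : zmodType) (i : 'I_n) (f : fps T A) : fps T A :=
  fun alpha => f alpha *+ alpha i.

Lemma fps_euler_conv (A B C : zmodType) (op : A -> B -> C)
    (f : fps T A) (g : fps T B) (i : 'I_n) :
  biadditive op ->
  fps_euler i (conv op f g) =
    conv op (fps_euler i f) g + conv op f (fps_euler i g).
Proof.
move=> opB; apply/funext => alpha; rewrite fpsDE /fps_euler /conv -big_split.
rewrite -sumrMnl; apply: eq_bigr => b le /=.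
rewrite (biadditive_mulrnl _ _ _ opB).
rewrite (biadditive_mulrnl _ _ _ (biadditive_flip opB)) -mulrnDr.
by rewrite addnC -mnmDE submK.
Qed.

(** At a multi-index that contains [i], the Euler operator is the partial
    derivative shifted by one, and the terms whose left multi-index does not
    contain [i] carry the factor 0. *)
Lemma conv_euler_partial (A C : lmodType F) (B : zmodType) (op : A -> B -> C)
    (f : fps T A) (g : fps T B) (i : 'I_n) alpha :
  biadditive op ->
  conv op (fps_euler i f) g (alpha + U_(i))%MM =
  conv op (fps_partial i f) g alpha.
Proof.
move=> opB; rewrite [LHS]/conv.
rewrite (bigID (fun b : 'X_{1..n < _} => bmnm b i == 0%N)) /= big1 ?add0r;
  last first.
  move=> b /andP[_ /eqP b0].
  by rewrite /fps_euler b0 (biadditive_mulrnl _ _ _ opB).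
have wd (b : 'X_{1..n < (mdeg alpha).+1}) :
    (mdeg (bmnm b + U_(i))%MM < (mdeg (alpha + U_(i))%MM).+1)%N.
  by rewrite !mdegD ltnS leq_add2r -ltnS bmdeg.
pose h b := BMultinom (wd b).
have lt0 : (mdeg (0%MM : 'X_{1..n}) < (mdeg alpha).+1)%N by rewrite mdeg0.
pose h' (b : 'X_{1..n < (mdeg (alpha + U_(i))%MM).+1}) :
    'X_{1..n < (mdeg alpha).+1} :=
  insubd (BMultinom lt0) (bmnm b - U_(i))%MM.
(* The remaining multi-indices are those of the form [b + U_(i)]. *)
rewrite (reindex_onto h h') /=; last first.
  move=> b /andP[_ bi]; apply: val_inj; rewrite /= /h' val_insubd.
  have le1 : (U_(i) <= bmnm b)%MM by rewrite lep1mP.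
  have -> : (mdeg (bmnm b - U_(i))%MM < (mdeg alpha).+1)%N.
    have E : (mdeg (bmnm b - U_(i))%MM).+1 = mdeg (bmnm b).
      by rewrite -addn1 -(mdeg1 i) -mdegD submK.
    by rewrite E -ltnS (leq_trans (bmdeg b)) // mdegD mdeg1 addn1.
  by rewrite submK.
apply: eq_big => [b|b _] /=.
  have -> : h' (h b) == b.
    by apply/eqP/val_inj; rewrite /h' val_insubd /= addmK bmdeg.
  rewrite mnmDE mnm1E eqxx addn1 !andbT.
  by apply/mnm_lepP/mnm_lepP => le k; have := le k; rewrite !mnmDE leq_add2r.
rewrite /fps_partial /fps_euler mnmDE mnm1E eqxx addn1.
congr (op _ (g _)); apply/mnmP => k; rewrite !(mnmBE, mnmDE).
by rewrite subnDr.
Qed.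

(** The Leibniz rule: the one for the Euler operator, read off at the
    multi-index [alpha + U_(i)], where the Euler operator multiplies by
    [alpha i + 1] just as the partial derivative at [alpha] does. *)
Lemma fps_partial_conv (A B C : lmodType F) (op : A -> B -> C)
    (f : fps T A) (g : fps T B) (i : 'I_n) :
  biadditive op ->
  fps_partial i (conv op f g) =
    conv op (fps_partial i f) g + conv op f (fps_partial i g).
Proof.
move=> opB; apply/funext => alpha; rewrite fpsDE.
rewrite (conv_flip op f (fps_partial i g)).
rewrite -(conv_euler_partial _ _ _ _ opB).
rewrite -(conv_euler_partial _ _ _ _ (biadditive_flip opB)).
rewrite -(conv_flip op f) -fpsDE -fps_euler_conv //.
by rewrite /fps_euler mnmDE mnm1E eqxx addn1.
Qed.

End Convolution.

(** * Differentials and their values on basis vectors *)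

Section Differential.
Context {F : fieldType} {T : vectType F} {W : lmodType F}.

Lemma fps_d_basis (f : fps T W) (i : 'I_(\dim {:T})) :
  fps_d f (vbasis {:T})`_i = fps_partial i f.
Proof.
apply/funext => alpha; rewrite /fps_d (bigD1 i) //= big1 => [|j ne].
  rewrite coord_free ?eqxx ?scale1r ?addr0 //.
  exact: basis_free (vbasisP _).
rewrite coord_free; last exact: basis_free (vbasisP _).
by rewrite eq_sym (negbTE ne) scale0r.
Qed.

Lemma fps_d_add (f g : fps T W) tau : fps_d (f + g) tau = fps_d f tau + fps_d g tau.
Proof.
apply/funext => alpha; rewrite fpsDE /fps_d -big_split; apply: eq_bigr => i _.
by rewrite /= -scalerDr /fps_partial fpsDE mulrnDl.
Qed.
End Differential.

Section Endomorphisms.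
Context {F : fieldType} {V T : vectType F}.
Local Notation K := (fps T F).
Local Notation VK := (fps T V).
Local Notation EndVK := (fps T 'End(V)).
Implicit Types A B N : EndVK.

Lemma biadd_comp : biadditive (@comp_lfun F V V V).
Proof. by split=> a x y; rewrite (comp_lfunDl, comp_lfunDr). Qed.

Lemma endo_mul_d_left A B tau :
  endo_mul (fps_d A tau) B = fun alpha => \sum_i
    coord (vbasis {:T}) i tau *: endo_mul (fps_partial i A) B alpha.
Proof.
apply/funext => alpha; rewrite /endo_mul /conv.
under [RHS]eq_bigr do rewrite scaler_sumr.
rewrite exchange_big; apply: eq_bigr => b _ /=.
have compD := biadd_comp.1 (B (alpha - bmnm b)%MM).
rewrite /fps_d (big_morph _ compD (morphD0 compD)).
by apply: eq_bigr => i _; rewrite comp_lfunZl.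
Qed.

Lemma endo_mul_d_right A B tau :
  endo_mul A (fps_d B tau) = fun alpha => \sum_i
    coord (vbasis {:T}) i tau *: endo_mul A (fps_partial i B) alpha.
Proof.
apply/funext => alpha; rewrite /endo_mul /conv.
under [RHS]eq_bigr do rewrite scaler_sumr.
rewrite exchange_big; apply: eq_bigr => b _ /=.
have compD := biadd_comp.2 (A (bmnm b)).
rewrite /fps_d (big_morph _ compD (morphD0 compD)).
by apply: eq_bigr => i _; rewrite comp_lfunZr.
Qed.

Lemma fps_d_endo_mul A B tau :
  fps_d (endo_mul A B) tau = endo_mul (fps_d A tau) B + endo_mul A (fps_d B tau).
Proof.
rewrite endo_mul_d_left endo_mul_d_right; apply/funext => alpha.
rewrite fpsDE -big_split; apply: eq_bigr => i _.
by rewrite /= -scalerDr {1}/endo_mul fps_partial_conv //; apply: biadd_comp.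
Qed.

(** Both sides are linear in the tangent vector, so that they can be compared on
    the basis of [T] in which [d_mu] is written. *)
Lemma fps_d_endo_mul_basis A B N :
  (forall i : 'I_(\dim {:T}), fps_d A (vbasis {:T})`_i =
     endo_mul (fps_d B (vbasis {:T})`_i) N) ->
  forall tau, fps_d A tau = endo_mul (fps_d B tau) N.
Proof.
move=> AB tau; rewrite endo_mul_d_left; apply/funext => alpha.
by apply: eq_bigr => i _; rewrite -!fps_d_basis AB.
Qed.

Lemma endo_appA A B v : endo_app (endo_mul A B) v = endo_app A (endo_app B v).
Proof.
apply: convA; [exact: biadd_app|exact: biadd_app|].
by move=> x y z; rewrite comp_lfunE.
Qed.

Lemma endo_appDl A B v : endo_app (A + B) v = endo_app A v + endo_app B v.
Proof. by apply: convDl; apply: biadd_app. Qed.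

Definition fps_const (v : V) : VK := fun alpha => if alpha == 0%MM then v else 0.

Lemma endo_app_const A v alpha : endo_app A (fps_const v) alpha = A alpha v.
Proof.
rewrite /endo_app conv_flip /conv.
have lt0 : (mdeg (0%MM : 'X_{1..\dim {:T}}) < (mdeg alpha).+1)%N.
  by rewrite mdeg0.
rewrite (bigD1 (BMultinom lt0)) /=; last first.
  by apply/mnm_lepP => i; rewrite mnm0E.
rewrite big1 => [|b /andP[_ nb]]; first by rewrite /fps_const eqxx subm0 addr0.
by move: nb; rewrite bmeqP /= /fps_const => /negbTE ->; rewrite linear0.
Qed.

(** An endomorphism-valued series can be recovered from its values on constant
    series; this turns identities between coefficients of [phi] and [mu] into
    identities between the [M a b]. *)
Lemma endo_app_inj A B : (forall v, endo_app A v = endo_app B v) -> A = B.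
Proof.
move=> AB; apply/funext => alpha; apply/lfunP => v.
by rewrite -!endo_app_const AB.
Qed.

End Endomorphisms.

(** * Surjective endomorphisms of V[[t]] *)

Section FreeModule.
Context {F : fieldType} {V T : vectType F}.
Local Notation K := (fps T F).
Local Notation VK := (fps T V).

Definition fps_coord (u : VK) : 'rV[K]_(\dim {:V}) :=
  \row_i (fun alpha => coord (vbasis {:V}) i (u alpha)).

Definition fps_of_coord (r : 'rV[K]_(\dim {:V})) : VK :=
  fun alpha => \sum_i r ord0 i alpha *: (vbasis {:V})`_i.

Lemma fps_coord_is_linear : linear fps_coord.
Proof.
move=> k u v; apply/rowP => i; rewrite !mxE; apply/funext => alpha.
rewrite !fpsDE linearD; congr (_ + _).
rewrite [LHS]linear_sum [RHS]/(fps_mul _ _ _) /fps_mul /conv.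
by apply: eq_bigr => b _; rewrite linearZ.
Qed.
HB.instance Definition _ :=
  GRing.isLinear.Build K VK _ _ fps_coord fps_coord_is_linear.

Lemma fps_coordK : cancel fps_coord fps_of_coord.
Proof.
move=> u; apply/funext => alpha; rewrite [RHS](coord_vbasis (memvf _)).
by apply: eq_bigr => i _; rewrite mxE.
Qed.

Lemma fps_of_coordK : cancel fps_of_coord fps_coord.
Proof.
move=> r; apply/rowP => i; rewrite mxE; apply/funext => alpha.
by rewrite coord_sum_free //; apply: basis_free (vbasisP _).
Qed.

Lemma fps_of_coord_is_linear : linear fps_of_coord.
Proof. exact: can2_linear fps_coordK fps_of_coordK. Qed.
HB.instance Definition _ :=
  GRing.isLinear.Build K _ VK _ fps_of_coord fps_of_coord_is_linear.

(** In a basis of [V] the map becomes a square matrix over the commutative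
    ring K; surjectivity is a one-sided inverse, and for square matrices over
    a commutative ring a one-sided inverse is two-sided. *)
Lemma surjective_endo_injective (h : {linear VK -> VK}) :
  (forall w, exists u, h u = w) -> injective h.
Proof.
move=> h_surj.
pose H := lin1_mx (fps_coord \o h \o fps_of_coord).
have HE u : fps_coord u *m H = fps_coord (h u).
  by rewrite mul_rV_lin1 /= fps_coordK.
have /choice[s hs] : forall i, exists u, h u = fps_of_coord (delta_mx ord0 i).
  by move=> i; apply: h_surj.
pose S := \matrix_i fps_coord (s i).
have SH : S *m H = 1%:M.
  by apply/row_matrixP => i; rewrite row_mul rowK HE hs fps_of_coordK row1.
have HS := mulmx1C SH.
move=> u v huv; apply: (can_inj fps_coordK).
by rewrite -[LHS]mulmx1 -[RHS]mulmx1 -HS !mulmxA !HE huv.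
Qed.
End FreeModule.

(** * Coefficients of mu and phi on monomials *)

Section Coefficients.
Context {F : fieldType} {V T : vectType F}.
Local Notation K := (fps T F).
Local Notation VK := (fps T V).
Local Notation Vplus := (Vplus V T).
Local Notation Vminus := (Vminus V T).

(** The coefficient of [(-z)^(-a-1)], so that [mcoef] inverts [minus_series]. *)
Definition mcoef (a : nat) (h : Vminus) : VK := (-1) ^+ a.+1 *: h (Negz a).

Lemma mcoef_is_linear a : linear (mcoef a).
Proof.
move=> c g h; rewrite /mcoef scalerA mulrC -scalerA -scalerDr.
by rewrite (_ : (c *: g + h) (Negz a) = c *: g (Negz a) + h (Negz a)).
Qed.
HB.instance Definition _ a :=
  GRing.isLinear.Build K Vminus VK _ (mcoef a) (mcoef_is_linear a).

Lemma signrK (W : lmodType K) a (w : W) : (-1) ^+ a *: ((-1) ^+ a *: w) = w.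
Proof. by rewrite scalerA -exprMn mulrNN mulr1 expr1n scale1r. Qed.

Lemma mcoef_series (h : nat -> VK) a : mcoef a (minus_series h) = h a.
Proof. exact: signrK. Qed.

Lemma mcoef_inj (g h : Vminus) : (forall a, mcoef a g = mcoef a h) -> g = h.
Proof.
move=> gh; apply/val_inj/val_inj/funext; case=> a /=.
  by have /asboolP-> // := minus_valP g; have /asboolP-> // := minus_valP h.
by rewrite -[LHS](signrK a.+1) -[RHS](signrK a.+1); congr (_ *: _); apply: gh.
Qed.

Fact zmon_laurent i (v : VK) :
  (fun k : int => if k == Posz i then v else 0) \in laurent_pred (V := V) (T := T).
Proof.
by apply/asboolP; exists (Posz i) => k; rewrite lt_neqAle eq_sym => /andP[/negbTE->].
Qed.
Fact zmon_plus i (v : VK) : Laurent (zmon_laurent i v) \in plus_pred (V := V) (T := T).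
Proof. by apply/asboolP; case. Qed.
Definition zmon i (v : VK) : Vplus := VPlus (zmon_plus i v).

Lemma zmonE i v k : zmon i v k = if k == Posz i then v else 0.
Proof. by []. Qed.

Lemma zmon_is_linear i : linear (zmon i).
Proof.
move=> c u v; apply/val_inj/val_inj/funext => k /=.
rewrite [RHS](_ : _ = c *: zmon i u k + zmon i v k) // !zmonE.
by case: ifP; rewrite // scaler0 addr0.
Qed.
HB.instance Definition _ i :=
  GRing.isLinear.Build K VK Vplus _ (zmon i) (zmon_is_linear i).

Lemma Vplus_inj (f g : Vplus) : (forall i : nat, f (Posz i) = g (Posz i)) -> f = g.
Proof.
move=> fg; apply/val_inj/val_inj/funext; case=> a /=; first exact: fg.
by have /asboolP-> // := plus_valP f; have /asboolP-> // := plus_valP g.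
Qed.

Lemma zmon_sum (f : Vplus) n : (forall i, (n <= i)%N -> f (Posz i) = 0) ->
  f = \sum_(i < n) zmon i (f (Posz i)).
Proof.
move=> fn; apply: Vplus_inj => k.
rewrite (big_morph (fun g : Vplus => g (Posz k)) (id1 := 0) (op1 := +%R)) //.
have [nk|kn] := leqP n k.
  rewrite fn // big1 // => i _; rewrite zmonE eqz_nat gtn_eqF //.
  exact: leq_trans (ltn_ord i) nk.
rewrite (bigD1 (Ordinal kn)) //= eqxx big1 ?addr0 // => i ne.
by move: ne; rewrite eqz_nat -val_eqE eq_sym /= => /negbTE->.
Qed.

Lemma linear_zmon_ext (W : lmodType K) (f g : {linear Vplus -> W}) :
  (forall i v, f (zmon i v) = g (zmon i v)) -> f =1 g.
Proof.
move=> fg q; have [n q0] := laurent_bound q.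
by rewrite (zmon_sum q0) !linear_sum; apply: eq_bigr => i _; apply: fg.
Qed.

Implicit Types M N : nat -> nat -> fps T 'End(V).

Lemma mcoef_mu_zmon M a i v : mcoef a (mu M (zmon i v)) = endo_app (M a i) v.
Proof.
rewrite mcoef_series (@mu_sumE _ _ _ _ _ i.+1) => [|k]; last first.
  by move=> ik; rewrite zmonE eqz_nat gtn_eqF.
rewrite big_nat_recr //= eqxx big1_seq ?add0r // => k.
rewrite mem_index_iota => /andP[_ ki]; rewrite eqz_nat ltn_eqF //.
exact: linear0.
Qed.

(** The component in [V_+] of [z^-1 (f + mu f)]; [mu f] does not contribute to
    it ([shiftE]). *)
Definition shift M (f : Vplus) : Vplus := plus_part (zinv (jmu M f)).

Lemma mcoef0_phi M f :
  mcoef 0 (phi M f) =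
  - f (Posz 0) - mcoef 0 (mu M (shift M f)).
Proof.
rewrite /phi /proj linearB; congr (_ - _).
rewrite [LHS]/(mcoef _ _) /mcoef expr1 scaleN1r; congr (- _).
rewrite [LHS](_ : _ = f (Posz 0) + mu M f (Posz 0)) //.
by have /asboolP-> := minus_valP (mu M f); rewrite ?addr0.
Qed.

Lemma mcoefS_phi M f a :
  mcoef a.+1 (phi M f) =
  - mcoef a (mu M f) - mcoef a.+1 (mu M (shift M f)).
Proof.
rewrite /phi /proj linearB; congr (_ - _).
rewrite [LHS]/(mcoef _ _) [in RHS]/mcoef /mcoef exprS mulN1r scaleNr; congr (- (_ *: _)).
rewrite [LHS](_ : _ = f (Negz a.+1 + 1) + mu M f (Negz a.+1 + 1)) //.
rewrite (_ : Negz a.+1 + 1 = Negz a); last by rewrite !NegzE -addn1 PoszD opprD subrK.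
by have /asboolP-> := plus_valP f; rewrite ?add0r.
Qed.

Lemma shiftE M f i : shift M f (Posz i) = f (Posz i.+1).
Proof.
rewrite [LHS](_ : _ = f (Posz i + 1) + mu M f (Posz i + 1)) // -PoszD addn1.
by have /asboolP-> := minus_valP (mu M f); rewrite ?addr0.
Qed.

Lemma shift_zmon0 M v : shift M (zmon 0 v) = 0.
Proof. by apply: Vplus_inj => i; rewrite shiftE zmonE. Qed.

Lemma shift_zmonS M i v : shift M (zmon i.+1 v) = zmon i v.
Proof. by apply: Vplus_inj => k; rewrite shiftE !zmonE !eqz_nat eqSS. Qed.

Lemma mcoef_mu0 M a : mcoef a (mu M 0) = 0.
Proof. by rewrite (linear0 (mu M)) (linear0 (mcoef a)). Qed.

(** On [v z^(i+1)] the leading coefficient produces [M 0 i], and on constants the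
    other coefficients produce [M a 0]; composing the two gives the products
    [M a 0 * M 0 i] of the master equations. *)
Lemma mcoef0_phi_zmon0 M v : mcoef 0 (phi M (zmon 0 v)) = - v.
Proof. by rewrite mcoef0_phi shift_zmon0 mcoef_mu0 subr0. Qed.

Lemma mcoef0_phi_zmonS M i v :
  mcoef 0 (phi M (zmon i.+1 v)) = - endo_app (M 0%N i) v.
Proof. by rewrite mcoef0_phi shift_zmonS mcoef_mu_zmon zmonE oppr0 sub0r. Qed.

Lemma mcoefS_phi_zmon0 M a v :
  mcoef a.+1 (phi M (zmon 0 v)) = - endo_app (M a 0%N) v.
Proof. by rewrite mcoefS_phi shift_zmon0 mcoef_mu0 subr0 mcoef_mu_zmon. Qed.

Lemma mcoefS_phi_zmonS M a i v :
  mcoef a.+1 (phi M (zmon i.+1 v)) = - endo_app (M a.+1 i + M a i.+1) v.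
Proof.
by rewrite mcoefS_phi shift_zmonS !mcoef_mu_zmon endo_appDl opprD addrC.
Qed.

(** * The projection onto constants defined by the leading coefficient of phi *)

(** The projection of [V_+] onto the constants along the kernel of the leading
    coefficient of [phi]: the sign is there because that coefficient is [- v] on
    the constant [v]. *)
Definition retract M (f : Vplus) : Vplus := zmon 0 (- mcoef 0 (phi M f)).

Lemma retract_is_linear M : linear (retract M).
Proof.
move=> c f g; rewrite /retract (linearP (phi M)) (linearP (mcoef 0)).
by rewrite opprD -scalerN (linearP (zmon 0)).
Qed.
HB.instance Definition _ M :=
  GRing.isLinear.Build K Vplus Vplus _ (retract M) (retract_is_linear M).

Lemma retract_zmon0 M v : retract M (zmon 0 v) = zmon 0 v.
Proof. by rewrite /retract mcoef0_phi_zmon0 opprK. Qed.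

Lemma retract_zmonS M i v :
  retract M (zmon i.+1 v) = zmon 0 (endo_app (M 0%N i) v).
Proof. by rewrite /retract mcoef0_phi_zmonS opprK. Qed.

Lemma mcoef0_phi_retract M f : mcoef 0 (phi M (retract M f)) = mcoef 0 (phi M f).
Proof. by rewrite mcoef0_phi_zmon0 opprK. Qed.

(** On [v z^(i+1)] the two sides have the same leading coefficient, and their
    next coefficients are minus the two sides of the third master equation
    applied to [v]. *)
Lemma phi_retractP M :
  (forall f, phi M f = phi M (retract M f)) <->
  (forall a b, M a.+1 b + M a b.+1 = endo_mul (M a 0%N) (M 0%N b)).
Proof.
split=> [phir a b|ME].
  apply: endo_app_inj => v; apply: oppr_inj.
  by rewrite -mcoefS_phi_zmonS phir retract_zmonS mcoefS_phi_zmon0 endo_appA.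
apply: (linear_zmon_ext (g := phi M \o retract M)) => -[|i] v /=.
  by rewrite retract_zmon0.
apply: mcoef_inj; case=> [|a]; first by rewrite mcoef0_phi_retract.
by rewrite retract_zmonS mcoefS_phi_zmonS mcoefS_phi_zmon0 ME endo_appA.
Qed.

(** For [N] a derivative of [M], this is the second master equation. *)
Lemma mu_retractP M N :
  (forall f, mu N f = mu N (retract M f)) <->
  (forall a b, N a b.+1 = endo_mul (N a 0%N) (M 0%N b)).
Proof.
split=> [mur a b|NE].
  apply: endo_app_inj => v.
  by rewrite -mcoef_mu_zmon mur retract_zmonS mcoef_mu_zmon endo_appA.
apply: (linear_zmon_ext (g := mu N \o retract M)) => -[|i] v /=.
  by rewrite retract_zmon0.
apply: mcoef_inj => a.
by rewrite retract_zmonS !mcoef_mu_zmon NE endo_appA.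
Qed.

(** On constants [phi] is injective, since its leading coefficient is there;
    this gives the isomorphism when [phi] factors through the constants.
    Conversely, the leading coefficient is always onto [V[[t]]], so on an image
    abstractly isomorphic to [V[[t]]] it is a surjective endomorphism of a free
    module of finite rank, and therefore separates points. *)
Lemma image_iso_VP M :
  image_iso_V M <-> (forall f, phi M f = phi M (retract M f)).
Proof.
split=> [[g [g_inj g_range]] f|phir]; last first.
  exists (phi M \o zmon 0); split=> [u v /= uv|].
    by apply: oppr_inj; rewrite -!(mcoef0_phi_zmon0 M) uv.
  apply/seteqP; split=> _ [x _ <-]; first by exists (zmon 0 x).
  by exists (- mcoef 0 (phi M x)) => //=; rewrite phir.
have lead_surj w : exists u, (mcoef 0 \o g) u = w.
  have : range (phi M) (phi M (zmon 0 (- w))) by exists (zmon 0 (- w)).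
  rewrite -g_range => -[u _ gu]; exists u.
  by rewrite /= gu mcoef0_phi_zmon0 opprK.
have lead_inj := surjective_endo_injective lead_surj.
have im_f : range (phi M) (phi M f) by exists f.
have im_rf : range (phi M) (phi M (retract M f)) by exists (retract M f).
move: im_f im_rf; rewrite -g_range => -[u _ gu] [v _ gv].
by rewrite -gu -gv (lead_inj u v) //= gu gv mcoef0_phi_retract.
Qed.

(** A factorization of [d mu] through [phi] takes equal values at [f] and
    [retract M f], which [phi] does not distinguish.  Conversely, [retract M f]
    depends only on the leading coefficient of [phi f], which gives an explicit
    factorization. *)
Lemma d_mu_factorsP M :
  (forall f, phi M f = phi M (retract M f)) ->
  d_mu_factors M <->
  (forall (i : 'I_(\dim {:T})) f,
     mu (fun a b => fps_d (M a b) (vbasis {:T})`_i) f =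
     mu (fun a b => fps_d (M a b) (vbasis {:T})`_i) (retract M f)).
Proof.
move=> phir; split=> [[psi psiE] i f|dmur].
  have d_mu_single g : d_mu M [ffun j => if j == i then g else 0] =
      mu (fun a b => fps_d (M a b) (vbasis {:T})`_i) g.
    rewrite /d_mu (bigD1 i) //= ffunE eqxx big1 ?addr0 // => j /negbTE ne.
    by rewrite ffunE ne linear0.
  rewrite -!d_mu_single !psiE; congr (psi _); apply/ffunP => j.
  by rewrite !ffunE; case: ifP.
pose psi (w : tensT Vminus) : Vminus := \sum_(i < \dim {:T})
  mu (fun a b => fps_d (M a b) (vbasis {:T})`_i) (zmon 0 (- mcoef 0 (w i))).
have psi_linear : linear psi.
  move=> c w w'; rewrite /psi scaler_sumr -big_split; apply: eq_bigr => i _ /=.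
  rewrite !ffunE (linearP (mcoef 0)) opprD -scalerN (linearP (zmon 0)).
  by rewrite (linearP (mu _)).
pose psiL := GRing.isLinear.Build K (tensT Vminus) Vminus _ psi psi_linear.
exists (HB.pack_for {linear tensT Vminus -> Vminus} psi psiL) => w /=.
by apply: eq_bigr => i _; rewrite dmur ffunE.
Qed.

End Coefficients.

(** * The master equations *)

(** The argument is algebraic and works over any field; the first master
    equation is the differential of the third minus the second. *)
Theorem master_equationsP (F : fieldType) (V T : vectType F)
    (M : nat -> nat -> fps T 'End(V)) :
  master_equations M <-> (image_iso_V M /\ d_mu_factors M).
Proof.
split=> [ME|[/image_iso_VP phir dmu]].
  have phir : forall f, phi M f = phi M (retract M f).
    by apply/phi_retractP => a b; case: (ME a b).
  split; first exact/image_iso_VP.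
  apply/(d_mu_factorsP phir) => i; apply/mu_retractP => a b.
  by case: (ME a b) => _ -> _.
have /phi_retractP sumE := phir.
have dE a b : forall tau,
    fps_d (M a b.+1) tau = endo_mul (fps_d (M a 0%N) tau) (M 0%N b).
  apply: fps_d_endo_mul_basis => i.
  move: a b; apply/(mu_retractP M (fun a b => fps_d (M a b) (vbasis {:T})`_i)).
  exact: (d_mu_factorsP phir).1.
move=> a b; split=> // tau.
by apply: (addIr (fps_d (M a b.+1) tau)); rewrite -fps_d_add sumE fps_d_endo_mul dE addrC.
Qed.

Theorem lemma5p1 (R : realType) (V T : vectType R[i])
    (M : nat -> nat -> fps T 'End(V)) :
  master_equations M <-> (image_iso_V M /\ d_mu_factors M).
Proof. exact: master_equationsP. Qed.
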